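(* Let a finite discounted MDP and a feature matrix $\Phi\in\mathbb{R}^{|\mathcal S||\mathcal A|\times p}$ be given (notation as in the context), let $d$ be a probability distribution on $\mathcal S\times\mathcal A$ with $d(s,a)>0$ for all $(s,a)$, and assume $\Phi^\top D_d\Phi$ is invertible. Consider the approximate value iteration $$\theta_{k+1}=(\Phi^\top D_d\Phi)^{-1}\Phi^\top D_d\big(R+\gamma P\Pi_{\pi^g_{\theta_k}}\Phi\theta_k\big),\qquad \theta_0\in\mathbb{R}^p,\ k=0,1,2,\dots$$ Let $\mathcal D$ be the set of points at which $\theta\mapsto F(\theta,\pi^g_\theta,d)$ is differentiable. If $$\sup_{\theta\in\mathcal D}\gamma\big\|\Phi(\Phi^\top D_d\Phi)^{-1}\Phi^\top D_dP\Pi_{\pi^g_\theta}\big\|_\infty<1\qquad\text{or}\qquad \sup_{\theta\in\mathcal D}\gamma\big\|(\Phi^\top D_d\Phi)^{-1}\Phi^\top D_dP\Pi_{\pi^g_\theta}\Phi\big\|_\infty<1,$$ then there is a unique $\theta^*\in\mathbb{R}^p$ with $F(\theta^*,\pi^g_{\theta^*},d)=0$, and $\theta_k\to\theta^*$ as $k\to\infty$.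
   Context: MDP: $\mathcal S=\{1,\dots,|\mathcal S|\}$ and $\mathcal A=\{1,\dots,|\mathcal A|\}$ are finite state and action sets, $\gamma\in(0,1)$ is the discount factor, $\mathcal P(s'\mid s,a)$ is the transition kernel, $r:\mathcal S\times\mathcal A\times\mathcal S\to\mathbb{R}$ is a bounded reward. A policy is a map from $\mathcal S$ to probability distributions on $\mathcal A$. Vectors/matrices indexed by $\mathcal S\times\mathcal A$ use index $(s-1)|\mathcal A|+a$ for $(s,a)$. $P\in\mathbb{R}^{|\mathcal S||\mathcal A|\times|\mathcal S|}$ has entries $[P]_{(s,a),s'}=\mathcal P(s'\mid s,a)$; $R\in\mathbb{R}^{|\mathcal S||\mathcal A|}$ has entries $[R]_{(s,a)}=\sum_{s'}\mathcal P(s'\mid s,a)r(s,a,s')$; $\Phi\in\mathbb{R}^{|\mathcal S||\mathcal A|\times p}$ has $(s,a)$-row $\phi(s,a)^\top$ with given features $\phi(s,a)\in\mathbb{R}^p$; for a policy $\pi$, $\Pi_\pi\in\mathbb{R}^{|\mathcal S|\times|\mathcal S||\mathcal A|}$ has entries $[\Pi_\pi]_{s,(s',a')}=\pi(a'\mid s)$ if $s'=s$ and $0$ otherwise. $D_d$ is the diagonal matrix with $(s,a)$ diagonal entry $d(s,a)$. The greedy policy $\pi^g_\theta$ is the deterministic policy choosing in state $s$ an action in $\arg\max_{a\in\mathcal A}\phi(s,a)^\top\theta$ (it depends on $\theta$ only through $\Phi\theta$), ties being broken by a fixed rule. $F(\theta,\pi,d)=\Phi^\top D_d R+\big(\gamma\Phi^\top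 D_d P\Pi_\pi\Phi-\Phi^\top D_d\Phi\big)\theta$. $\|\cdot\|_\infty$ on matrices is the maximum absolute row sum. *)

(* Defs.v *)
From HB Require Import structures.
From mathcomp Require Import all_boot all_order all_algebra.
From mathcomp Require Import all_classical all_reals all_analysis.
Import Order.TTheory GRing.Theory Num.Theory.
Import numFieldNormedType.Exports.

Set Implicit Arguments.
Unset Strict Implicit.
Unset Printing Implicit Defensive.

Local Open Scope classical_set_scope.
Local Open Scope ring_scope.

Definition is_distr (R : realType) (T : finType) (f : T -> R) : Prop :=
  (forall x, 0 <= f x) /\ \sum_x f x = 1.

(* The reward is automatically bounded, its domain being finite. *)
Record mdp (R : realType) (nS nA : nat) := Mdp {
  discount : R;
  trans : 'I_nS -> 'I_nA -> 'I_nS -> R;  (* [trans s a s'] is P(s' | s, a) *)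
  reward : 'I_nS -> 'I_nA -> 'I_nS -> R;
  discountP : 0 < discount < 1;
  transP : forall s a, is_distr (trans s a) }.

(* [policy_prob pi s a] is pi(a | s). *)
Record policy (R : realType) (nS nA : nat) := Policy {
  policy_prob :> 'I_nS -> 'I_nA -> R;
  policyP : forall s, is_distr (policy_prob s) }.

Lemma is_distr_dirac (R : realType) (T : finType) (x : T) :
  is_distr (fun y => (y == x)%:R : R).
Proof.
split=> [y|]; first exact: ler0n.
by rewrite (bigD1 x) //= eqxx big1 ?addr0 // => y /negPf ->.
Qed.

Definition det_policy (R : realType) (nS nA : nat) (f : 'I_nS -> 'I_nA) :
  policy R nS nA :=
  Policy (fun s => is_distr_dirac R (f s)).

(* Vectors and matrices indexed by state-action pairs are indexed by
   'I_(nS * nA), the pair (s, a) having index [mxvec_index s a].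
   [sa_fun f] turns a function of (s, a) into a function of that index,
   as [sa_funE] shows. *)
Definition sa_fun (T : Type) (nS nA : nat) (f : 'I_nS -> 'I_nA -> T)
    (i : 'I_(nS * nA)) : T :=
  mxvec (\matrix_(s, a) f s a) 0 i.

Lemma sa_funE (T : Type) (nS nA : nat) (f : 'I_nS -> 'I_nA -> T) s a :
  sa_fun f (mxvec_index s a) = f s a.
Proof. by rewrite /sa_fun mxvecE mxE. Qed.

Section Matrices.
Context (R : realType) (nS nA p : nat).
Implicit Types (M : mdp R nS nA) (phi : 'I_nS -> 'I_nA -> 'cV[R]_p).
Implicit Types (pi : policy R nS nA) (d : 'I_nS * 'I_nA -> R).

Definition trans_mx M : 'M[R]_(nS * nA, nS) :=
  \matrix_(i, s') sa_fun (fun s a => trans M s a s') i.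

Definition reward_vec M : 'cV[R]_(nS * nA) :=
  \col_i sa_fun (fun s a => \sum_s' trans M s a s' * reward M s a s') i.

Definition feature_mx phi : 'M[R]_(nS * nA, p) :=
  \matrix_(i, j) sa_fun (fun s a => phi s a j 0) i.

Definition policy_mx pi : 'M[R]_(nS, nS * nA) :=
  \matrix_(s, i) sa_fun (fun s' a' => if s' == s then pi s a' else 0) i.

Definition weight_mx d : 'M[R]_(nS * nA) :=
  diag_mx (\row_i sa_fun (fun s a => d (s, a)) i).

(* A greedy selection rule with a fixed way of breaking ties: to a vector [q]
   of action values and a state it assigns a maximizing action. *)
Definition greedy_rule (g : 'cV[R]_(nS * nA) -> 'I_nS -> 'I_nA) : Prop :=
  forall (q : 'cV[R]_(nS * nA)) s a,
    q (mxvec_index s a) 0 <= q (mxvec_index s (g q s)) 0.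

Definition greedy_policy (g : 'cV[R]_(nS * nA) -> 'I_nS -> 'I_nA) phi
    (theta : 'cV[R]_p) : policy R nS nA :=
  det_policy R (g (feature_mx phi *m theta)).

Definition F_map M phi (theta : 'cV[R]_p) pi d : 'cV[R]_p :=
  let Phi := feature_mx phi in
  let D := weight_mx d in
  Phi^T *m D *m reward_vec M
  + (discount M *: (Phi^T *m D *m trans_mx M *m policy_mx pi *m Phi)
     - Phi^T *m D *m Phi) *m theta.

Definition gram_mx phi d : 'M[R]_p :=
  (feature_mx phi)^T *m weight_mx d *m feature_mx phi.

Definition avi_step M phi d g (theta : 'cV[R]_p) : 'cV[R]_p :=
  let Phi := feature_mx phi in
  invmx (gram_mx phi d) *m Phi^T *m weight_mx d *m
    (reward_vec M + discount M *:
       (trans_mx M *m policy_mx (greedy_policy g phi theta) *m Phi *m theta)).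

Definition diff_points M phi d g : set 'cV[R]_p :=
  [set theta | differentiable
     (fun th : 'cV[R]_p => F_map M phi th (greedy_policy g phi th) d) theta].

End Matrices.

(* Maximum absolute row sum; the norm [`|A|] that MathComp-Analysis puts on
   matrices is instead the largest absolute value of an entry. *)
Definition mx_norm_inf (R : realType) (m n : nat) (A : 'M[R]_(m, n)) : R :=
  \big[Num.max/0]_(i < m) \sum_(j < n) `|A i j|.

(* Main.v *)
(* The greedy value [max_a phi(s,a)^T theta] is a piecewise linear function of
   [theta], with slope [Pi_theta Phi] wherever no two distinct features of a
   state tie; such points are dense and belong to the set of differentiability
   points.  Under the second condition, a segment starting at a point without
   ties meets ties at finitely many parameters only, and between two of these
   the iteration map is affine with a slope of norm at most the supremum; so the
   map is a contraction.  Under the first condition, the induced map on action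
   values is a contraction because the greedy value is nonexpansive for the sup
   norm.  Banach's theorem concludes in both cases. *)

Require Import Defs.
From HB Require Import structures.
From mathcomp Require Import all_boot all_order all_algebra.
From mathcomp Require Import all_classical all_reals all_analysis.
From mathcomp Require Import ring lra.
Import Order.TTheory GRing.Theory Num.Theory.
Import numFieldNormedType.Exports.

Set Implicit Arguments.
Unset Strict Implicit.
Unset Printing Implicit Defensive.

Local Open Scope classical_set_scope.
Local Open Scope ring_scope.

(** * Preliminaries: fixed points on complete spaces, differentiability, norms *)

HB.instance Definition _ (R : realType) (m n : nat) :=
  Complete.copy 'M[R]_(m, n) 'M[R]_(m, n).

(** Banach's theorem: every orbit converges to a fixed point, so uniqueness makes the limit
    independent of the start. *)
Lemma contraction_iter_cvg (R : realType) (X : completeNormedModType R)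
    (f : X -> X) (c : R) :
  0 <= c < 1 -> (forall x y, `|f x - f y| <= c * `|x - y|) ->
  exists x, [/\ f x = x, forall y, f y = y -> y = x
    & forall x0, (fun k => iter k f x0) @ \oo --> x].
Proof.
move=> /andP[c0 c1] fc.
pose ft : {fun [set: X] >-> [set: X]} := totalfun f.
have ctr : contraction (NngNum c0) ft.
  by split=> //= -[x y] _ /=; exact: fc.
have fixU (x y : X) : f x = x -> f y = y -> y = x.
  move=> fx fy.
  apply: (contraction_fixpoint_unique (U := setT) (f := ft)) => //.
  by exists (NngNum c0).
have cvgP (x0 : X) : exists2 x, f x = x & (fun k => iter k f x0) @ \oo --> x.
  exists (lim ((fun k => iter k f x0) @ \oo)).
    by apply/esym; exact: (contraction_cvg_fixed ctr (base := x0) I closedT).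
  exact: (contraction_cvg ctr (base := x0) I).
have [x fx _] := cvgP 0.
exists x; split=> // [y fy|x0]; first exact: fixU.
by have [y fy] := cvgP x0; rewrite (fixU _ _ fx fy).
Qed.

(** The first-order expansion of [h] at [x] is also one for [f], and [diff_unique] then identifies
    the differential. *)
Lemma near_eq_differentiable (R : numFieldType) (V W : normedModType R)
    (f h : V -> W) (x : V) :
  (\forall y \near x, f y = h y) -> differentiable h x -> differentiable f x.
Proof.
move=> fh dh.
have fhx := nbhs_singleton fh.
have fE : f \o shift x = cst (f x) + 'd h x +o_ 0 id.
  apply/eqaddoP => e e0.
  have /eqaddoP/(_ e e0) := diff_locally dh.
  have fh0 : \forall y \near (0 : V), f (y + x) = h (y + x).
    by move: fh; rewrite (near_shift 0); apply: filterS => y /=; rewrite subr0.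
  apply: filterS2 fh0 => y fhy.
  by rewrite /= !fctE /= fhy fhx.
have dhc := diff_continuous dh.
by apply/diff_locallyP; rewrite (diff_unique dhc fE).
Qed.

Lemma mx_entry_le_norm (R : realType) (m n : nat) (A : 'M[R]_(m, n)) i j :
  `|A i j| <= `|A|.
Proof.
rewrite [leRHS]/Num.Def.normr/= mx_normrE.
exact: (le_bigmax _ (fun ij : 'I_m * 'I_n => `|A ij.1 ij.2|) (i, j)).
Qed.

Lemma mx_norm_le (R : realType) (m n : nat) (A : 'M[R]_(m, n)) (e : R) :
  0 <= e -> (forall i j, `|A i j| <= e) -> `|A| <= e.
Proof.
move=> e0 Ae; rewrite [leLHS]/Num.Def.normr/= mx_normrE.
by apply: bigmax_le => // -[i j] _; exact: Ae.
Qed.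

Lemma mx_norm_inf_ge0 (R : realType) (m n : nat) (A : 'M[R]_(m, n)) :
  0 <= mx_norm_inf A.
Proof. exact: bigmax_ge_id. Qed.

Lemma normr_mulmx_le (R : realType) (m n : nat) (A : 'M[R]_(m, n))
    (x : 'cV[R]_n) :
  `|A *m x| <= mx_norm_inf A * `|x|.
Proof.
apply: mx_norm_le => [|i j]; first by rewrite mulr_ge0 ?mx_norm_inf_ge0.
rewrite mxE; apply: le_trans (ler_norm_sum _ _ _) _.
apply: (@le_trans _ _ (\sum_k `|A i k| * `|x|)).
  by apply: ler_sum => k _; rewrite normrM ler_wpM2l// mx_entry_le_norm.
rewrite -mulr_suml ler_wpM2r//.
exact: (le_bigmax _ (fun i => \sum_k `|A i k|) i).
Qed.

Lemma mulmx_colvec_continuous (R : realType) (m n : nat) (A : 'M[R]_(m, n)) :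
  continuous (mulmx A : 'cV[R]_n -> 'cV[R]_m).
Proof.
apply/linear_bounded_continuous/linear_boundedP.
near=> r => x; apply: le_trans (normr_mulmx_le _ _) _.
by apply: ler_wpM2r => //; near: r; exact: nbhs_pinfty_ge.
Unshelve. all: by end_near. Qed.

Lemma ereal_sup_lt1_bound (R : realType) (T : Type) (D : set T) (f : T -> R) :
  (ereal_sup [set (f x)%:E | x in D] < 1)%E ->
  exists2 c, 0 <= c < 1 & forall x, D x -> f x <= c.
Proof.
have fsup x : D x -> ((f x)%:E <= ereal_sup [set (f x)%:E | x in D])%E.
  by move=> Dx; apply: ereal_sup_ubound; exists x.
case: ereal_sup fsup => [r fr|//|foo _].
  (* The maximum with [0] makes the contraction constant nonnegative. In the remaining case the
     supremum is [-oo] and [D] is empty. *)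
  rewrite lte_fin => r1; exists (Num.max 0 r).
    by rewrite le_max lexx /= gt_max ltr01.
  by move=> x /fr; rewrite lee_fin le_max => ->; rewrite orbT.
by exists 0 => [|x /foo //]; rewrite lexx ltr01.
Qed.

(** A negative value at [t] would put a root strictly between [t] and [m], hence inside the open
    interval even when [t] is an endpoint. *)
Lemma affine_ge0_of_no_root (R : realType) (u0 u1 a b m t : R) :
  a < m < b -> a <= t <= b -> 0 < u0 + m * u1 ->
  (forall r, a < r < b -> u0 + r * u1 != 0) -> 0 <= u0 + t * u1.
Proof.
move=> /andP[am mb] /andP[at_ tb] um noroot.
rewrite leNgt; apply/negP => ut.
have u1N0 : u1 != 0 by apply/eqP => u10; move: ut um; rewrite u10; lra.
have ruE : u0 + (- u0 / u1) * u1 = 0 by rewrite divfK // subrr.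
set r := - u0 / u1 in ruE.
suff /noroot : a < r < b by rewrite ruE eqxx.
case: (ltrgt0P u1) u1N0 => // u1s _.
  have tr : t < r by rewrite -(ltr_pM2r u1s); lra.
  have rm : r < m by rewrite -(ltr_pM2r u1s); lra.
  by apply/andP; split; lra.
have rt : r < t by rewrite -(ltr_nM2r u1s); lra.
have mr : m < r by rewrite -(ltr_nM2r u1s); lra.
by apply/andP; split; lra.
Qed.

Lemma poly_exists_small_nonroot (R : realFieldType) (P : {poly R}) (e : R) :
  P != 0 -> 0 < e -> exists2 x, 0 < x <= e & ~~ root P x.
Proof.
move=> P0 e0; apply: contrapT => allroot.
(* As many distinct points of [(0, e]] as the size of [P], one more than its degree. *)
pose rs := [seq e / k.+1%:R | k <- iota 0 (size P)].
have := @max_poly_roots _ P rs P0; rewrite size_map size_iota ltnn => contra.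
suff : false by []; apply: contra.
  apply/allP => _ /mapP[k _ ->]; apply/negPn/negP => nroot; apply: allroot.
  exists (e / k.+1%:R) => //; rewrite divr_gt0 //=.
  by rewrite ler_pdivrMr // ler_pMr // ler1n.
rewrite map_inj_uniq ?iota_uniq // => i j /(mulfI (lt0r_neq0 e0))/invr_inj.
by move=> /eqP; rewrite eqr_nat => /eqP[].
Qed.

(** * The greedy value and its behaviour near tie-free parameters *)

Section GreedyValue.
Context (R : realType) (nS nA p : nat).
Implicit Types (q : 'cV[R]_(nS * nA)) (pi : policy R nS nA).
Implicit Types (x y theta : 'cV[R]_p).

Lemma policy_mx_mulE pi q s :
  (policy_mx pi *m q) s 0 = \sum_a pi s a * q (mxvec_index s a) 0.
Proof.
rewrite mxE (reindex _ (curry_mxvec_bij _ _)) /=.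
rewrite (eq_bigr (fun j : 'I_nS * 'I_nA =>
  (if j.1 == s then pi s j.2 else 0) * q (mxvec_index j.1 j.2) 0)); last first.
  by move=> [s' a] _ /=; rewrite mxE sa_funE.
rewrite -(pair_big predT predT (fun s' a =>
  (if s' == s then pi s a else 0) * q (mxvec_index s' a) 0)) /=.
rewrite (bigD1 s) //= [X in _ + X]big1 ?addr0.
  by apply: eq_bigr => a _; rewrite eqxx.
by move=> s' /negPf s's; rewrite big1 // => a _; rewrite s's mul0r.
Qed.

Lemma det_policy_mx_mulE (f : 'I_nS -> 'I_nA) q s :
  (policy_mx (det_policy R f) *m q) s 0 = q (mxvec_index s (f s)) 0.
Proof.
rewrite policy_mx_mulE (bigD1 (f s)) //= eqxx mul1r big1 ?addr0 //.
by move=> a /negPf ->; rewrite mul0r.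
Qed.

(** Rows of a policy matrix sum to one, so repeating a state vector over the actions gives a
    preimage that serves every policy at once. *)
Lemma policy_mx_mul_sa_fun pi (v : 'cV[R]_nS) :
  policy_mx pi *m (\col_i sa_fun (fun s _ => v s 0) i) = v.
Proof.
apply/colP => s; rewrite policy_mx_mulE.
under eq_bigr do rewrite mxE sa_funE.
by rewrite -mulr_suml; have [_ ->] := policyP pi s; rewrite mul1r.
Qed.

Variable g : 'cV[R]_(nS * nA) -> 'I_nS -> 'I_nA.
Hypothesis gP : greedy_rule g.

(** For greedy [g], the vector of [max_a q(s, a)], whatever the tie-breaking. *)
Definition greedy_value q : 'cV[R]_nS := policy_mx (det_policy R (g q)) *m q.

Lemma greedy_value_maximizer (f : 'I_nS -> 'I_nA) q :
  (forall s a, q (mxvec_index s a) 0 <= q (mxvec_index s (f s)) 0) ->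
  greedy_value q = policy_mx (det_policy R f) *m q.
Proof.
move=> fmax; apply/colP => s; rewrite !det_policy_mx_mulE.
by apply/le_anti; rewrite fmax gP.
Qed.

Lemma greedy_value_nonexpansive q q' :
  `|greedy_value q - greedy_value q'| <= `|q - q'|.
Proof.
apply: mx_norm_le => // s j; rewrite (ord1 j).
rewrite [X in `|X|]mxE [(- greedy_value q') _ _]mxE.
rewrite !det_policy_mx_mulE ler_norml.
have := gP q s (g q' s); have := gP q' s (g q s).
have := mx_entry_le_norm (q - q') (mxvec_index s (g q s)) 0.
have := mx_entry_le_norm (q - q') (mxvec_index s (g q' s)) 0.
rewrite !mxE !ler_norml => /andP[l1 u1] /andP[l2 u2] m1 m2.
by apply/andP; split; lra.
Qed.

Variable phi : 'I_nS -> 'I_nA -> 'cV[R]_p.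
Let Phi := feature_mx phi.

Lemma feature_mx_mulE theta s a :
  (Phi *m theta) (mxvec_index s a) 0 = \sum_j phi s a j 0 * theta j 0.
Proof. by rewrite mxE; apply: eq_bigr => j _; rewrite mxE sa_funE. Qed.

(** Actions with equal features are exempt: they tie at every parameter, and choosing between them
    does not change the value. *)
Definition no_ties theta : Prop := forall s a b, phi s a != phi s b ->
  (Phi *m theta) (mxvec_index s a) 0 != (Phi *m theta) (mxvec_index s b) 0.

(** Strict inequalities between action values persist by continuity, so the actions greedy at
    [theta] remain maximizing nearby. *)
Lemma greedy_value_near theta : no_ties theta ->
  \forall th \near theta, greedy_value (Phi *m th) =
    policy_mx (greedy_policy g phi theta) *m (Phi *m th).
Proof.
move=> ntie; near=> th; apply: greedy_value_maximizer.
near: th; apply: filter_forall => s; apply: filter_forall => a.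
set b := g _ s.
have [eqf|neqf] := eqVneq (phi s a) (phi s b).
  by apply: nearW => th; rewrite !feature_mx_mulE eqf.
have lt_ab : (Phi *m theta) (mxvec_index s a) 0
    < (Phi *m theta) (mxvec_index s b) 0.
  by rewrite lt_neqAle ntie // gP.
have entry_cvg i : (fun th => (Phi *m th) i 0) @ theta --> (Phi *m theta) i 0.
  apply: (@continuous_comp 'cV[R]_p 'cV[R]_(nS * nA) R (mulmx Phi)
    (fun v => v i 0)); first exact: mulmx_colvec_continuous.
  exact: coord_continuous.
have diff_cvg : (fun th => (Phi *m th) (mxvec_index s b) 0
    - (Phi *m th) (mxvec_index s a) 0) @ theta -->
    (Phi *m theta) (mxvec_index s b) 0 - (Phi *m theta) (mxvec_index s a) 0.
  exact: (@cvgB _ _ _ (nbhs theta) _ _ _ _ _ (entry_cvg _) (entry_cvg _)).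
have := cvgr_gt _ diff_cvg 0; rewrite subr_gt0 => /(_ _ lt_ab) gt0.
by apply: filterS gt0 => th; rewrite subr_gt0 => /ltW.
Unshelve. all: by end_near. Qed.

(** * Lipschitz bound along a segment *)

Section Segment.
Context (m : nat) (A : 'M[R]_(m, nS)) (c : R) (x y : 'cV[R]_p).
Hypothesis c_bound : forall theta, no_ties theta ->
  mx_norm_inf (A *m policy_mx (greedy_policy g phi theta) *m Phi) <= c.

Let line (t : R) := x + t *: (y - x).
Let W theta := greedy_value (Phi *m theta).

Let line_valueE t i : (Phi *m line t) i 0 =
  (Phi *m x) i 0 + t * ((Phi *m y) i 0 - (Phi *m x) i 0).
Proof. by rewrite mulmxDr -scalemxAr mulmxBr !mxE. Qed.

(** The selection greedy at the midpoint stays maximizing up to both ends, since losing optimality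
    would force a tie inside. Hence [W] is affine in the parameter, with the slope bounded at the
    midpoint. *)
Lemma greedy_value_segment_no_ties a b : a < b ->
  (forall t, a < t < b -> no_ties (line t)) ->
  `|A *m (W (line b) - W (line a))| <= c * ((b - a) * `|y - x|).
Proof.
move=> ab ntie.
pose mid := (a + b) / 2%:R.
have midab : a < mid < b by rewrite /mid; apply/andP; split; lra.
pose f := g (Phi *m line mid).
have fmax t : a <= t <= b ->
    W (line t) = policy_mx (det_policy R f) *m (Phi *m line t).
  move=> tab; apply: greedy_value_maximizer => s a'.
  have [eqf|neqf] := eqVneq (phi s (f s)) (phi s a').
    by rewrite !feature_mx_mulE eqf.
  pose u0 := (Phi *m x) (mxvec_index s (f s)) 0
    - (Phi *m x) (mxvec_index s a') 0.
  pose v0 := (Phi *m y) (mxvec_index s (f s)) 0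
    - (Phi *m y) (mxvec_index s a') 0.
  have uE r : (Phi *m line r) (mxvec_index s (f s)) 0
      - (Phi *m line r) (mxvec_index s a') 0 = u0 + r * (v0 - u0).
    by rewrite !line_valueE /u0 /v0; ring.
  rewrite -subr_ge0 uE; apply: (affine_ge0_of_no_root midab tab).
    rewrite -uE subr_gt0 lt_neqAle gP andbT eq_sym.
    exact: (ntie _ midab _ _ _ neqf).
  by move=> r rab; rewrite -uE subr_eq0; exact: (ntie _ rab _ _ _ neqf).
rewrite !fmax ?lexx ?(ltW ab) // -!mulmxBr.
have -> : line b - line a = (b - a) *: (y - x).
  by rewrite /line opprD addrACA subrr add0r -scalerBl.
rewrite !mulmxA; apply: le_trans (normr_mulmx_le _ _) _.
rewrite normrZ gtr0_norm ?subr_gt0 // ler_wpM2r //;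
  first by rewrite mulr_ge0 ?subr_ge0 ?(ltW ab).
exact: c_bound (ntie _ midab).
Qed.

Lemma greedy_value_segment_finite_ties (ties : seq R) a b : a <= b ->
  (forall t, a < t < b -> t \notin ties -> no_ties (line t)) ->
  `|A *m (W (line b) - W (line a))| <= c * ((b - a) * `|y - x|).
Proof.
elim: ties a b => [|r ties IH] a b ab ntie;
  move: (ab); rewrite le_eqVlt => /predU1P[->|ltab].
- by rewrite !subrr mulmx0 normr0 mul0r mulr0.
- by apply: greedy_value_segment_no_ties => // t /ntie; exact.
- by rewrite !subrr mulmx0 normr0 mul0r mulr0.
(* A tie [r] inside the interval splits it, and the two bounds add up; a tie outside is dropped. *)
have [/andP[ar rb]|rab] := boolP (a < r < b); last first.
  apply: IH => // t tab tties; apply: ntie => //.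
  rewrite inE negb_or tties andbT.
  by apply: contraNneq rab => <-.
have -> : W (line b) - W (line a) =
    (W (line b) - W (line r)) + (W (line r) - W (line a)).
  by rewrite addrA subrK.
rewrite mulmxDr; apply: le_trans (ler_normD _ _) _.
have -> : c * ((b - a) * `|y - x|) =
    c * ((b - r) * `|y - x|) + c * ((r - a) * `|y - x|) by ring.
apply: lerD; apply: IH; rewrite ?ltW // => t /andP[t1 t2] tties;
  apply: ntie; rewrite ?inE ?negb_or ?tties ?andbT.
- by rewrite t2 (lt_trans ar t1).
- by rewrite gt_eqF.
- by rewrite t1 (lt_trans t2 rb).
- by rewrite lt_eqF.
Qed.

Lemma finite_ties_on_line : no_ties x ->
  exists ties : seq R, forall t, t \notin ties -> no_ties (line t).
Proof.
move=> ntx.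
pose gap (z : 'cV[R]_p) (k : 'I_nS * 'I_nA * 'I_nA) :=
  (Phi *m z) (mxvec_index k.1.1 k.1.2) 0 - (Phi *m z) (mxvec_index k.1.1 k.2) 0.
(* The only possible root of each affine gap. Triples of zero slope contribute a harmless [0]. *)
exists [seq - gap x k / (gap y k - gap x k)
  | k <- enum {: 'I_nS * 'I_nA * 'I_nA}].
move=> t tties s a b neqf; apply: contra tties => /eqP eqt.
pose k := (s, a, b).
apply/mapP; exists k; first by rewrite mem_enum.
have gx0 : gap x k != 0 by rewrite subr_eq0; exact: ntx.
have gt0 : gap x k + t * (gap y k - gap x k) = 0.
  have : gap (line t) k = 0 by rewrite /gap /= eqt subrr.
  by rewrite /gap /= !line_valueE => <-; ring.
have dN0 : gap y k - gap x k != 0.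
  by apply: contra_neq gx0 => d0; move: gt0; rewrite d0 mulr0 addr0.
by apply: (mulIf dN0); rewrite divfK //; apply/eqP; rewrite -addr_eq0 addrC gt0.
Qed.

Lemma greedy_value_lipschitz_from_no_ties : no_ties x ->
  `|A *m (W y - W x)| <= c * `|y - x|.
Proof.
move=> /finite_ties_on_line[ties ntie].
have := @greedy_value_segment_finite_ties ties 0 1 ler01 (fun t _ => ntie t).
by rewrite /line scale0r scale1r addr0 [x + (y - x)]addrC subrK subr0 mul1r.
Qed.

End Segment.

(* The perturbation runs along the moment curve (e, e^2, ..., e^p), which stays
   in the hyperplane of a tie for only finitely many e. *)
Lemma no_ties_dense theta (e : R) : 0 < e ->
  exists2 x, no_ties x & `|x - theta| <= e.
Proof.
move=> e0.
pose gap (z : 'cV[R]_p) (k : 'I_nS * 'I_nA * 'I_nA) :=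
  (Phi *m z) (mxvec_index k.1.1 k.1.2) 0 - (Phi *m z) (mxvec_index k.1.1 k.2) 0.
(* [P k] evaluated at [h] is the gap at the perturbed parameter; its coefficients of positive degree
   are the entries of the feature difference. *)
pose P (k : 'I_nS * 'I_nA * 'I_nA) : {poly R} := (gap theta k)%:P
  + \sum_(i < p) (phi k.1.1 k.1.2 i 0 - phi k.1.1 k.2 i 0) *: 'X^(i.+1).
pose Q := \prod_(k | phi k.1.1 k.1.2 != phi k.1.1 k.2) P k.
have Q0 : Q != 0.
  apply/prodf_neq0 => k neqf; apply: contra_neq neqf => Pk0.
  apply/colP => i; apply/eqP; rewrite -subr_eq0; apply/eqP.
  have : (P k)`_(i.+1) = 0 by rewrite Pk0 coef0.
  rewrite coefD coefC add0r coef_sum (bigD1 i) //= coefZ coefXn eqxx mulr1.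
  rewrite big1 ?addr0 // => j ji; rewrite coefZ coefXn eqSS.
  by rewrite [_ == _ :> nat](negPf _) ?mulr0 // eq_sym.
(* With [h <= 1], all the powers of [h] used are at most [h], hence at most [e]. *)
have me : 0 < Num.min e 1 by rewrite lt_min e0 ltr01.
have [h /andP[h0]] := poly_exists_small_nonroot Q0 me.
rewrite le_min => /andP[he h1] Qh.
pose w : 'cV[R]_p := \col_i h ^+ i.+1.
exists (theta + w); last first.
  rewrite addrAC subrr add0r; apply: mx_norm_le => [|i j]; first exact: ltW.
  rewrite mxE ger0_norm ?exprn_ge0 ?(ltW h0) //.
  by rewrite (le_trans _ he) // exprS ger_pMr // exprn_ile1 // ltW.
move=> s a b neqf; pose k := (s, a, b).
rewrite -subr_eq0 -[X in X != 0]/(gap (theta + w) k).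
suff -> : gap (theta + w) k = (P k).[h].
  move: Qh; rewrite /root horner_prod => /prodf_neq0/(_ k neqf).
  by [].
rewrite hornerD hornerC horner_sum /gap mulmxDr !mxE opprD addrACA.
congr (_ + _); rewrite -sumrB; apply: eq_bigr => i _.
by rewrite hornerZ hornerXn !mxE !sa_funE mulrBl.
Qed.

Lemma greedy_value_lipschitz (m : nat) (A : 'M[R]_(m, nS)) (c : R) : 0 <= c ->
  (forall theta, no_ties theta ->
    mx_norm_inf (A *m policy_mx (greedy_policy g phi theta) *m Phi) <= c) ->
  forall x y,
    `|A *m (greedy_value (Phi *m y) - greedy_value (Phi *m x))| <= c * `|y - x|.
Proof.
move=> c0 c_bound x y; apply/ler_addgt0Pr => e e0.
pose L := mx_norm_inf A * mx_norm_inf Phi.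
have L0 : 0 <= L by rewrite mulr_ge0 ?mx_norm_inf_ge0.
(* Moving the start from [x] to a tie-free [x'] within [del] costs at most [(c + L) * del]; the
   added [1] keeps the divisor positive. *)
have D0 : 0 < c + L + 1 by rewrite ltr_wpDl // addr_ge0.
have [x' ntx' xx'] := no_ties_dense x (divr_gt0 e0 D0).
set del := e / _ in xx'.
have delE : del * (c + L + 1) = e by rewrite divfK // gt_eqF.
have -> : greedy_value (Phi *m y) - greedy_value (Phi *m x) =
   (greedy_value (Phi *m y) - greedy_value (Phi *m x'))
   + (greedy_value (Phi *m x') - greedy_value (Phi *m x)).
  by rewrite addrA subrK.
rewrite mulmxDr; apply: le_trans (ler_normD _ _) _.
have h1 := greedy_value_lipschitz_from_no_ties y c_bound ntx'.
have h2 :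
    `|A *m (greedy_value (Phi *m x') - greedy_value (Phi *m x))| <= L * del.
  apply: le_trans (normr_mulmx_le _ _) _; rewrite -mulrA.
  rewrite ler_wpM2l ?mx_norm_inf_ge0 //.
  apply: le_trans (greedy_value_nonexpansive _ _) _.
  rewrite -mulmxBr; apply: le_trans (normr_mulmx_le _ _) _.
  by rewrite ler_wpM2l ?mx_norm_inf_ge0.
have h3 : `|y - x'| <= `|y - x| + del.
  apply: le_trans (ler_distD x _ _) _.
  by rewrite lerD2l distrC.
have h4 : c * `|y - x'| <= c * (`|y - x| + del) by rewrite ler_wpM2l.
have del0 : 0 <= del by rewrite divr_ge0 // ltW.
apply: le_trans (lerD h1 h2) _; rewrite -delE.
rewrite mulrDr in h4; rewrite !mulrDr mulr1 [del * c]mulrC [del * L]mulrC.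
by apply: le_trans (lerD h4 (lexx _)) _; lra.
Qed.

End GreedyValue.

(** * Approximate value iteration as a fixed-point problem *)

Section ApproximateValueIteration.
Context (R : realType) (nS nA p : nat) (M : mdp R nS nA).
Context (phi : 'I_nS -> 'I_nA -> 'cV[R]_p) (d : 'I_nS * 'I_nA -> R).
Context (g : 'cV[R]_(nS * nA) -> 'I_nS -> 'I_nA).
Hypotheses (gP : greedy_rule g) (Gunit : gram_mx phi d \in unitmx).

Let Phi := feature_mx phi.
Let B := invmx (gram_mx phi d) *m Phi^T *m weight_mx d *m trans_mx M.
Let step := avi_step M phi d g.

(** [F_map] sees the policy only through the greedy value, which near [theta] agrees with that of
    the policy frozen at [theta]; so [F_map] is locally affine. *)
Lemma no_ties_diff_points theta :
  no_ties phi theta -> diff_points M phi d g theta.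
Proof.
move=> ntie; rewrite /diff_points /=.
pose pi := greedy_policy g phi theta.
apply: (near_eq_differentiable (h := fun th => F_map M phi th pi d)).
  have := greedy_value_near gP ntie; apply: filterS => th.
  rewrite /greedy_value -/(greedy_policy g phi th) => valE.
  by rewrite /F_map !mulmxBl -!scalemxAl -!mulmxA valE.
apply: differentiableD; first exact: differentiable_cst.
apply: (@linear_differentiable _ _ _ (mulmx _)).
exact: mulmx_colvec_continuous.
Qed.

Definition avi_update (q : 'cV[R]_(nS * nA)) : 'cV[R]_p :=
  invmx (gram_mx phi d) *m Phi^T *m weight_mx d *m reward_vec M
  + discount M *: (B *m greedy_value g q).

Lemma avi_stepE theta : step theta = avi_update (Phi *m theta).
Proof.
rewrite /step /avi_step mulmxDr -scalemxAr.
by rewrite /avi_update /greedy_value /B /greedy_policy -!mulmxA.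
Qed.

Lemma avi_update_sub q q' : avi_update q - avi_update q' =
  discount M *: (B *m (greedy_value g q - greedy_value g q')).
Proof. by rewrite /avi_update opprD addrACA subrr add0r -scalerBr -mulmxBr. Qed.

Lemma avi_update_lipschitz q q' : `|avi_update q - avi_update q'|
  <= discount M * mx_norm_inf B * `|q - q'|.
Proof.
have /andP[gam0 _] := discountP M.
rewrite avi_update_sub normrZ gtr0_norm // -mulrA ler_wpM2l ?(ltW gam0) //.
apply: le_trans (normr_mulmx_le _ _) _.
by rewrite ler_wpM2l ?mx_norm_inf_ge0 // greedy_value_nonexpansive.
Qed.

(** Multiplying by the Gram matrix cancels the inverse in the step; zeros of [F_map] thus become
    fixed points. *)
Lemma F_map_avi_step theta :
  F_map M phi theta (greedy_policy g phi theta) d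
  = gram_mx phi d *m (step theta - theta).
Proof.
rewrite mulmxBr /step /avi_step !mulmxA mulmxV // mul1mx.
rewrite /F_map mulmxBl addrA mulmxDr; congr (_ + _ - _).
by rewrite -scalemxAr -scalemxAl !mulmxA.
Qed.

Lemma F_map_eq0 theta :
  F_map M phi theta (greedy_policy g phi theta) d = 0 <-> step theta = theta.
Proof.
rewrite F_map_avi_step; split=> [|->]; last by rewrite subrr mulmx0.
by move=> /(congr1 (mulmx (invmx (gram_mx phi d)))); rewrite mulKmx // mulmx0
  => /subr0_eq.
Qed.

Lemma avi_step_contraction (c : R) : 0 <= c ->
  (forall theta, diff_points M phi d g theta -> discount M * mx_norm_inf
     (B *m policy_mx (greedy_policy g phi theta) *m Phi) <= c) ->
  forall x y, `|step x - step y| <= c * `|x - y|.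
Proof.
have /andP[gam0 _] := discountP M.
move=> c0 c_bound x y; rewrite !avi_stepE avi_update_sub normrZ gtr0_norm //.
(* The discount moves to the right, giving the Lipschitz constant [c / discount M]. *)
rewrite mulrC -ler_pdivlMr // mulrAC.
apply: greedy_value_lipschitz => // [|theta ntie].
  by rewrite divr_ge0 // ltW.
by rewrite ler_pdivlMr // mulrC c_bound //; exact: no_ties_diff_points.
Qed.

(** A bound at one [theta] suffices: the difference [v] of greedy values is the image, under that
    one policy matrix, of its copy [w] over the actions, which is no larger in norm. *)
Lemma feature_avi_update_contraction (c : R) theta :
  discount M * mx_norm_inf
     (Phi *m B *m policy_mx (greedy_policy g phi theta)) <= c ->
  forall q q', `|Phi *m avi_update q - Phi *m avi_update q'| <= c * `|q - q'|.
Proof.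
have /andP[gam0 _] := discountP M.
move=> c_bound q q'; rewrite -mulmxBr avi_update_sub -scalemxAr mulmxA.
set v := greedy_value _ _ - _.
rewrite -(policy_mx_mul_sa_fun (greedy_policy g phi theta) v) mulmxA.
set w := \col_i _; rewrite normrZ gtr0_norm //.
have wv : `|w| <= `|v|.
  apply: mx_norm_le => // i j.
  by case/mxvec_indexP: i => s a; rewrite mxE sa_funE; exact: mx_entry_le_norm.
have wq : `|w| <= `|q - q'|.
  by apply: le_trans wv _; exact: greedy_value_nonexpansive.
have c0 : 0 <= c.
  by apply: le_trans c_bound; rewrite mulr_ge0 ?mx_norm_inf_ge0 // ltW.
apply: (@le_trans _ _ (c * `|w|)); last by rewrite ler_wpM2l.
apply: le_trans (ler_wpM2r (normr_ge0 w) c_bound).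
by rewrite -mulrA ler_wpM2l ?normr_mulmx_le // ltW.
Qed.

(* [step] is [avi_update \o mulmx Phi], hence semiconjugate to the contraction
   [mulmx Phi \o avi_update] of the action values. *)
Lemma avi_cvg_of_feature_contraction (c : R) : 0 <= c < 1 ->
  (forall q q',
     `|Phi *m avi_update q - Phi *m avi_update q'| <= c * `|q - q'|) ->
  exists x, [/\ step x = x, forall y, step y = y -> y = x
    & forall x0, (fun k => iter k step x0) @ \oo --> x].
Proof.
move=> c01 fc.
pose f q := Phi *m avi_update q.
have [q [fq funiq fcvg]] := contraction_iter_cvg c01 (f := f) fc.
exists (avi_update q); split=> [|y stepy|x0].
- by rewrite avi_stepE -/(f q) fq.
(* The action values of any fixed point of [step] are fixed by [f], hence equal [q]. *)
- have yE : y = avi_update (Phi *m y) by rewrite -avi_stepE.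
  by rewrite yE (funiq (Phi *m y)) // /f -yE.
have iterE k : iter k.+1 step x0 = avi_update (iter k f (Phi *m x0)).
  by elim: k => [|k IH]; rewrite iterS ?IH avi_stepE.
(* The shift is needed because [x0] itself may lie outside the range of [avi_update]. *)
rewrite -cvg_shiftS; under eq_fun do rewrite iterE.
pose K := discount M * mx_norm_inf B.
have K0 : 0 <= K.
  have /andP[gam0 _] := discountP M.
  by rewrite mulr_ge0 ?mx_norm_inf_ge0 // ltW.
apply/cvgrPdist_le => e e0.
have /cvgrPdist_le/(_ (e / (K + 1))) := fcvg (Phi *m x0).
rewrite divr_gt0 // ?ltr_wpDl // => /(_ isT).
apply: filterS => k qk; apply: le_trans (avi_update_lipschitz _ _) _.
apply: le_trans (ler_wpM2l K0 qk) _.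
by rewrite mulrCA ger_pMr // ler_pdivrMr ?ltr_wpDl // mul1r lerDl.
Qed.

End ApproximateValueIteration.

Theorem lemma12p2 (R : realType) (nS nA p : nat) (M : mdp R nS nA)
  (phi : 'I_nS -> 'I_nA -> 'cV[R]_p) (d : 'I_nS * 'I_nA -> R)
  (g : 'cV[R]_(nS * nA) -> 'I_nS -> 'I_nA) :
  greedy_rule g ->
  is_distr d ->
  (forall s a, 0 < d (s, a)) ->
  gram_mx phi d \in unitmx ->
  let Phi := feature_mx phi in
  let Dd := weight_mx d in
  let G := gram_mx phi d in
  let Pi := fun theta : 'cV[R]_p => policy_mx (greedy_policy g phi theta) in
  (ereal_sup [set (discount M * mx_norm_inf
       (Phi *m invmx G *m Phi^T *m Dd *m trans_mx M *m Pi theta))%:E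
     | theta in diff_points M phi d g] < 1)%E \/
  (ereal_sup [set (discount M * mx_norm_inf
       (invmx G *m Phi^T *m Dd *m trans_mx M *m Pi theta *m Phi))%:E
     | theta in diff_points M phi d g] < 1)%E ->
  exists theta_star : 'cV[R]_p,
    [/\ F_map M phi theta_star (greedy_policy g phi theta_star) d = 0,
        forall theta : 'cV[R]_p,
          F_map M phi theta (greedy_policy g phi theta) d = 0 ->
          theta = theta_star
      & forall theta0 : 'cV[R]_p,
          (fun k : nat => iter k (avi_step M phi d g) theta0) @ \oo
            --> theta_star].
Proof.
move=> gP _ _ Gunit Phi Dd G Pi sup_lt1.
suff [x [xE xuniq xcvg]] : exists x, [/\ avi_step M phi d g x = x,
    forall y, avi_step M phi d g y = y -> y = x
  & forall x0, (fun k => iter k (avi_step M phi d g) x0) @ \oo --> x].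
  exists x; split=> [|y Fy|//]; first exact/F_map_eq0.
  by apply: xuniq; exact/(F_map_eq0 _ _ Gunit).
case: sup_lt1 => /ereal_sup_lt1_bound[c c01 c_bound].
  (* Density supplies a tie-free parameter, at which the supremum bounds the norm. *)
  have [theta ntie _] := no_ties_dense phi 0 ltr01.
  apply: (avi_cvg_of_feature_contraction gP c01).
  apply: (feature_avi_update_contraction gP (theta := theta)).
  by have := c_bound _ (no_ties_diff_points M d gP ntie); rewrite !mulmxA.
have /andP[c0 _] := c01.
by apply: contraction_iter_cvg c01 _; exact: avi_step_contraction.
Qed.
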